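(* Let $b=p_1^{\alpha_1}\cdots p_k^{\alpha_k}$ be the prime factorization of an integer $b>1$ (distinct primes $p_j$, $\alpha_j\ge 1$), and let $\mathcal D$ be a tile digit set of $b$. Then for each $j\in\{1,\dots,k\}$ and each $0\leq \ell\leq \alpha_j-1$ there exists a unique integer $a_{j,\ell}\equiv \ell \pmod{\alpha_j}$ such that $\Phi_{p_j^{a_{j,\ell}}}(x)$ divides $P_{\mathcal D}(x)$, and the prime-power spectrum of $\mathcal D$ is $$S_{\mathcal D}=\bigcup_{j=1}^k\{p_j^{a_{j,0}},\dots,p_j^{a_{j,\alpha_j-1}}\}.$$
   Context: Let $b>1$ be an integer. A digit set is a finite set $\mathcal D\subset\mathbb{Z}_{\ge 0}$. For such $\mathcal D$, $T(b,\mathcal D)=\{\sum_{k=1}^\infty b^{-k}d_k: d_k\in\mathcal D\}$ is the unique nonempty compact set with $bT=T+\mathcal D$. $\mathcal D$ is called a tile digit set of $b$ if $\#\mathcal D=b$ and $T(b,\mathcal D)$ has nonempty interior (equivalently positive Lebesgue measure; it is then a translational tile of $\mathbb R$). The mask polynomial is $P_{\mathcal D}(x)=\sum_{d\in\mathcal D}x^d$. $\Phi_n$ denotes the $n$-th cyclotomic polynomial. The prime-power spectrum of $\mathcal D$ is $S_{\mathcal D}=\{p^\alpha>1: p \text{ prime},\ \Phi_{p^\alpha}(x)\mid P_{\mathcal D}(x)\}$. *)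

(* Defs.v *)
From HB Require Import structures.
From mathcomp Require Import all_boot all_order all_algebra.
From mathcomp Require Import cyclotomic.
From mathcomp Require Import finmap.
From mathcomp Require Import all_classical all_reals all_analysis.

Set Implicit Arguments.
Unset Strict Implicit.
Unset Printing Implicit Defensive.

Import Order.TTheory GRing.Theory Num.Theory.
Import numFieldNormedType.Exports.

Local Open Scope classical_set_scope.
Local Open Scope ring_scope.

(* The digit d_k (k >= 1) of the expansion is [d k.-1]: the k-th term of the
   series below, counted from 0, is b^{-(k+1)} d_{k+1}. *)
Definition digit_attractor (R : realType) (b : nat) (D : {fset nat}) : set R :=
  [set x | exists d : nat -> nat,
     (forall k, d k \in D) /\
     series (fun k => b%:R ^- k.+1 * (d k)%:R : R) @ \oo --> x].

Definition tile_digit_set (R : realType) (b : nat) (D : {fset nat}) : Prop :=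
  #|` D|%fset = b /\ interior (digit_attractor b D : set R) !=set0.

Definition mask_poly (D : {fset nat}) : {poly int} := \sum_(d <- D) 'X^d.

(* [%|] on [{poly int}] is pseudo-divisibility in general; for the monic
   divisors 'Phi_n it is divisibility in Z[x], see [dvd_CyclotomicP]. *)
Definition prime_power_spectrum (D : {fset nat}) : set nat :=
  [set q | exists p e : nat,
     [/\ prime p, q = (p ^ e)%N, (1 < q)%N & 'Phi_q %| mask_poly D]].

Lemma dvd_CyclotomicP (n : nat) (P : {poly int}) :
  reflect (exists Q, P = Q * 'Phi_n) ('Phi_n %| P).
Proof.
apply: (iffP idP) => [dvdP|[Q ->]]; last exact: dvdp_mulIr.
exists (P %/ 'Phi_n); rewrite Pdiv.IdomainUnit.divpK //.
by rewrite (monicP (Cyclotomic_monic n)) unitr1.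
Qed.

(* Main.v *)
(** Write [P] for the mask polynomial of [D] and [zeta_n = exp(2 i pi / b^n)].

    Since the attractor has interior, covering it by translates of [b^-n T]
    shows that the [b^n] sums [d_0 + b d_1 + ... + b^(n-1) d_(n-1)] are pairwise
    distinct.  Their exponential sum at [z] is [P(z) P(z^b) ... P(z^(b^(n-1)))],
    and by Parseval modulo [b^n] the squares of its values at the [b^n]-th roots
    of unity, divided by [b^(2n)], add up to a bounded quantity.  For [m > 0] the
    frequencies [m b^i / b^n] all contribute a partial product of
    [prod_k P(zeta_k^m) / b], so this product tends to 0; its tail is close
    to 1, hence some factor vanishes (Kenyon's criterion), that is, [Phi_N]
    divides [P] for [N] the reduced denominator of some [m / b^k].

    With [m] the product of [p^s] and a large power of the prime-to-[p]
    part of [b], [N] is a power of [p] whose exponent is prescribed modulo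
    [alpha].  Conversely [Phi_(p^c)(1) = p] and [P(1) = b], so at most
    [alpha] exponents [c > 0] satisfy [Phi_(p^c) | P]. *)
Require Import Defs.
From HB Require Import structures.
From mathcomp Require Import all_boot all_order all_algebra.
From mathcomp Require Import cyclotomic algC.
From mathcomp Require Import complex.
From mathcomp Require Import zify ring lra.
From mathcomp Require Import finmap.
From mathcomp Require Import all_classical all_reals all_analysis.

Set Implicit Arguments.
Unset Strict Implicit.
Unset Printing Implicit Defensive.

Import Order.TTheory GRing.Theory Num.Theory.
Import numFieldNormedType.Exports.

Local Open Scope classical_set_scope.
Local Open Scope ring_scope.

(** * Cyclotomic polynomials: roots and values at 1 *)

(** As a root of [X^n - 1], [z] is a root of some ['Phi_d] with [d] dividing [n]; then [z ^+ d = 1]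
    forces [d = n]. *)
Lemma root_Cyclotomic (F : numFieldType) n (z : F) :
  n.-primitive_root z -> root (map_poly intr 'Phi_n) z.
Proof.
move=> zn; have n_gt0 := prim_order_gt0 zn.
have /(congr1 (fun p => (map_poly intr p : {poly F}).[z])) :=
  prod_Cyclotomic n_gt0.
rewrite rmorphB /= map_polyXn rmorph1 !hornerE (prim_expr_order zn) subrr.
rewrite rmorph_prod horner_prod => /eqP; rewrite prodf_seq_eq0 => /hasP[d].
rewrite -dvdn_divisors // => dn /= /eqP zd.
have d_gt0 : (0 < d)%N := dvdn_gt0 n_gt0 dn.
have zd1 : z ^+ d = 1.
  apply/eqP; rewrite -subr_eq0.
  have /(congr1 (fun p => (map_poly intr p : {poly F}).[z])) :=
    prod_Cyclotomic d_gt0.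
  rewrite rmorphB /= map_polyXn rmorph1 !hornerE => <-.
  rewrite rmorph_prod horner_prod prodf_seq_eq0; apply/hasP; exists d => /=.
    by rewrite -dvdn_divisors.
  by rewrite zd.
have nd : (n %| d)%N by rewrite (prim_order_dvd zn) zd1.
have <- : d = n by apply/eqP; rewrite eqn_dvd dn nd.
by rewrite /root zd.
Qed.

(* [gcd(Phi_n, P)] has a root in [algC], whose minimal polynomial is [Phi_n]. *)
Lemma dvd_Cyclotomic_root (F : numFieldType) n (z : F) (P : {poly int}) :
  n.-primitive_root z -> ('Phi_n %| P) = root (map_poly intr P) z.
Proof.
move=> zn.
have mapr (L : numFieldType) (p : {poly int}) : map_poly intr p =
    map_poly (ratr : rat -> L) (map_poly intr p).
  by rewrite -map_poly_comp; apply: eq_map_poly => x /=; rewrite ratr_int.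
apply/idP/idP => [|Pz].
  rewrite -dvdp_rat_int => /dvdpP[q Pq].
  by rewrite (mapr F) Pq rmorphM rootM /= -mapr (root_Cyclotomic zn) orbT.
have n_gt0 := prim_order_gt0 zn.
set f := map_poly (intr : int -> rat) 'Phi_n.
set g := map_poly (intr : int -> rat) P.
have sz_h : size (gcdp f g) != 1.
  apply/negP; rewrite -/(coprimep f g) -(coprimep_map (ratr : {rmorphism rat -> F})).
  move=> /coprimep_root fg; have := root_Cyclotomic zn; rewrite (mapr F) => /fg.
  by rewrite -mapr -/(root _ z) Pz.
have [w hw] : exists w : algC, root (map_poly ratr (gcdp f g)) w.
  by apply/closed_rootP; rewrite size_map_poly.
have fw : root (map_poly ratr f) w.
  by have /dvdpP[q ->] := dvdp_gcdl f g; rewrite rmorphM rootM hw orbT.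
have wn : n.-primitive_root w.
  have [z' z'n] := C_prim_root_exists n_gt0.
  by rewrite -(root_cyclotomic z'n) -(Cintr_Cyclotomic z'n) mapr.
rewrite -dvdp_rat_int -/f -/g.
have [q [qE _] qP] := minCpolyP w.
have <- : q = f.
  apply: (map_poly_inj (ratr : {rmorphism rat -> algC})); rewrite /= -qE.
  by rewrite (minCpoly_cyclotomic wn) -(Cintr_Cyclotomic wn) mapr.
by apply: dvdp_trans (dvdp_gcdr f g); rewrite -qP.
Qed.

Lemma Cyclotomic1 : 'Phi_1 = 'X - 1%:P.
Proof. by rewrite -[RHS](prod_Cyclotomic (n := 1)) // big_seq1. Qed.

Lemma divisors_primeX p c : prime p ->
  perm_eq (divisors (p ^ c.+1)) (p ^ c.+1 :: divisors (p ^ c))%N.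
Proof.
move=> pp; apply: uniq_perm; rewrite /= ?divisors_uniq //.
  rewrite andbT -dvdn_divisors ?expn_gt0 ?prime_gt0 //.
  by rewrite dvdn_Pexp2l ?prime_gt1 // ltnn.
move=> d; rewrite inE -!dvdn_divisors ?expn_gt0 ?prime_gt0 //.
apply/(dvdn_pfactor _ _ pp)/orP => [[j]|[/eqP ->|] ].
- rewrite leq_eqVlt ltnS => /orP[/eqP-> ->|jc ->]; first by left.
  by right; apply: dvdn_exp2l.
- by exists c.+1.
by move=> /(dvdn_pfactor _ _ pp)[i ic ->]; exists i => //; apply: leqW.
Qed.

(* Differentiate [X^(p^c.+1) - 1 = Phi_(p^c.+1) (X^(p^c) - 1)] at 1. *)
Lemma Cyclotomic_primeX_horner1 p c : prime p -> ('Phi_(p ^ c.+1)).[1] = p%:R.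
Proof.
move=> pp; have p0 := prime_gt0 pp.
have := prod_Cyclotomic (n := p ^ c.+1); rewrite expn_gt0 p0 => /(_ isT).
rewrite (perm_big _ (divisors_primeX c pp)) big_cons prod_Cyclotomic ?expn_gt0 ?p0 //.
move=> /(congr1 (fun q : {poly int} => q^`().[1])).
rewrite !poly.derivE !hornerE /= !hornerMn !hornerXn !expr1n subrr mulr0 add0r.
rewrite expnS natrM => /(mulIf _)-> //.
by rewrite pnatr_eq0 expn_eq0 -leqn0 leqNgt p0.
Qed.

(** Each ['Phi_(p ^ c)] contributes a factor [p] at 1; they can be divided out in turn because
    distinct ones share no root. *)
Lemma dvdn_primeX_card p (cs : seq nat) (P : {poly int}) :
  prime p -> uniq cs -> 0%N \notin cs ->
  (forall c, c \in cs -> 'Phi_(p ^ c) %| P) ->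
  exists x : int, P.[1] = x * (p ^ size cs)%:R.
Proof.
move=> pp; elim: cs P => [|c cs IH] P /=; first by exists P.[1]; rewrite mulr1.
move=> /andP[ccs ucs]; rewrite inE negb_or => /andP[c0 cs0] dvdP.
have c_gt0 : (0 < c)%N by rewrite lt0n eq_sym.
have /Pdiv.IdomainUnit.dvdpP := dvdP c (mem_head _ _).
rewrite (monicP (Cyclotomic_monic _)) unitr1 => /(_ isT)[Q PQ].
have [|x xE] := IH Q ucs cs0.
  move=> d dcs; have pd0 : (0 < p ^ d)%N by rewrite expn_gt0 prime_gt0.
  have [z zd] := C_prim_root_exists pd0.
  have := dvdP d; rewrite inE dcs orbT => /(_ isT).
  rewrite !(dvd_Cyclotomic_root _ zd) PQ rmorphM rootM /= => /orP[//|].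
  have pc0 : (0 < p ^ c)%N by rewrite expn_gt0 prime_gt0.
  have [w wc] := C_prim_root_exists pc0.
  rewrite (Cintr_Cyclotomic wc) (root_cyclotomic wc) => zc.
  have : (p ^ c == p ^ d)%N.
    by rewrite eqn_dvd (prim_order_dvd zc) (prim_order_dvd zd)
      (prim_expr_order zc) (prim_expr_order zd) eqxx.
  rewrite eqn_exp2l ?prime_gt1 // => /eqP cd.
  by rewrite cd dcs in ccs.
exists x; rewrite PQ hornerM xE -(prednK c_gt0) Cyclotomic_primeX_horner1 //.
by rewrite expnSr natrM mulrA.
Qed.

(** * Digit sums in base [b] *)

(** Repetitions are kept, so that [uniq] states that different digit strings have different sums. *)
Fixpoint digit_sums (b : nat) (D : seq nat) (n : nat) : seq nat :=
  if n is m.+1 then [seq (d + b * x)%N | d <- D, x <- digit_sums b D m]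
  else [:: 0%N].

Lemma size_digit_sums b D n : size (digit_sums b D n) = (size D ^ n)%N.
Proof. by elim: n => //= n IH; rewrite size_allpairs IH expnS. Qed.

Lemma digit_sums_add b D m n :
  {subset digit_sums b D (m + n) <=
    [seq (x + b ^ m * y)%N | x <- digit_sums b D m, y <- digit_sums b D n]}.
Proof.
elim: m => [|m IH] u.
  by move=> un; apply/allpairsP; exists (0%N, u); rewrite /= mem_seq1 add0n mul1n.
move=> /allpairsP[[d x] /= [dD /IH/allpairsP[[v y] /= [vm yn ->]] ->]].
apply/allpairsP; exists ((d + b * v)%N, y); split=> //=.
  by apply/allpairsP; exists (d, v).
by rewrite mulnDr mulnA -expnS addnA.
Qed.

(** An expansion of length [k * n] splits into [n] blocks of length [k]. *)
Lemma size_undup_digit_sums b D k n :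
  (size (undup (digit_sums b D (k * n))) <=
   size (undup (digit_sums b D k)) ^ n)%N.
Proof.
elim: n => [|n IH]; first by rewrite muln0.
rewrite mulnS expnS (leq_trans _ (leq_mul (leqnn _) IH)) //.
rewrite -(size_allpairs (fun x y => x + b ^ k * y)%N).
apply: uniq_leq_size (undup_uniq _) _ => u; rewrite mem_undup.
move=> /digit_sums_add/allpairsP[[x y] [xk yn ->]].
by apply/allpairsP; exists (x, y); rewrite !mem_undup.
Qed.

(** The summand [A] on the left lets the induction close, as [d + A <= b * A]. *)
Lemma digit_sums_le b D A n u : (1 < b)%N -> (forall d, d \in D -> d <= A)%N ->
  u \in digit_sums b D n -> (u + A <= A * b ^ n)%N.
Proof.
move=> b1 DA; elim: n u => [|n IH] u; first by rewrite mem_seq1 => /eqP ->; lia.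
move=> /allpairsP[[d x] /= [/DA dA /IH xn ->]].
have : (b * (x + A) <= A * b ^ n.+1)%N by rewrite expnS mulnCA leq_mul2l xn orbT.
by apply: leq_trans; nia.
Qed.

(** * Attractor and distinctness of digit sums *)

Section Attractor.
Context (R : realType) (b : nat) (D : {fset nat}) (A : nat).
Hypotheses (b1 : (1 < b)%N) (DA : forall d, d \in D -> (d <= A)%N).

Let b0 : (0 : R) < b%:R.
Proof. by rewrite ltr0n ltnW. Qed.

(** The first [n] digits of [x] form [u]; the remainder [b^n x - u] is again a digit series, at most
    [A / (b - 1) <= A]. *)
Lemma digit_attractor_approx (x : R) n : digit_attractor b D x ->
  exists2 u, u \in digit_sums b D n & 0 <= b%:R ^+ n * x - u%:R <= A%:R.
Proof.
move=> [d [dD sx]]; set f := (X in series X) in sx.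
have fE k : f k = b%:R ^- k.+1 * (d k)%:R by [].
have [u un uE] : exists2 u, u \in digit_sums b D n &
    series f n = b%:R ^- n * u%:R.
  elim: n => [|n [u un uE]].
    by exists 0%N; rewrite ?mem_seq1 // seriesEnat /= big_geq // mulr0.
  exists (d n + b * u)%N; first by apply: allpairs_f => //; exact: dD.
  rewrite seriesSr uE fE natrD natrM mulrDr addrC; congr (_ + _).
  by rewrite exprSr invfM -mulrA mulKf ?gt_eqF.
have f_ge0 k : 0 <= f k by rewrite fE mulr_ge0 ?invr_ge0 ?exprn_ge0 ?ler0n.
exists u => //.
have s_ge : series f n <= x.
  have snd : {homo series f : i j / (i <= j)%N >-> i <= j}.
    by apply/nondecreasing_seqP => i; rewrite seriesSr lerDl.
  rewrite -(cvg_lim (@Rhausdorff R) sx); apply: nondecreasing_cvgn_le => //.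
  by apply/cvg_ex; exists x.
have s_le : x <= series f n + A%:R * b%:R ^- n.
  rewrite -(cvg_lim (@Rhausdorff R) sx); apply: limr_le.
    by apply/cvg_ex; exists x.
  exists n => // N /= nN.
  (* The partial sum plus [A * b ^- N] never increases with [N], since [d + A <= b * A]. *)
  suff: series f N + A%:R * b%:R ^- N <= series f n + A%:R * b%:R ^- n.
    by apply: le_trans; rewrite lerDl mulr_ge0 ?invr_ge0 ?exprn_ge0 ?ler0n.
  elim: N nN => [|N IH]; first by rewrite leqn0 => /eqP ->.
  rewrite leq_eqVlt => /orP[/eqP-> //|]; rewrite ltnS => /IH; apply: le_trans.
  rewrite seriesSr fE -addrA lerD2l [A%:R * _]mulrC -mulrDr.
  rewrite exprSr invfM -mulrA [A%:R * _]mulrC ler_wpM2l ?invr_ge0 ?exprn_ge0 ?ler0n //.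
  rewrite ler_pdivrMl // -natrD -natrM ler_nat.
  by have := DA (dD N); nia.
have bn0 : 0 < b%:R ^+ n :> R by rewrite exprn_gt0.
move: s_ge s_le; rewrite uE [A%:R * _]mulrC -mulrDr ler_pdivrMl // ler_pdivlMl //.
by move=> h1 h2; lra.
Qed.

End Attractor.

(** A ball in the attractor holds [b ^ (n - q)] points spaced by [2 * A / b ^ n]. After scaling by
    [b ^ n], each exceeds its digit sum by at most [A], so these sums differ. *)
Lemma digit_sums_interior (R : realType) b (D : {fset nat}) : (1 < b)%N ->
  interior (digit_attractor b D : set R) !=set0 ->
  exists q, forall n, (q <= n)%N ->
    (b ^ (n - q) <= size (undup (digit_sums b D n)))%N.
Proof.
move=> b1 [x0 [e /= e0 ballT]].
pose A := (\max_(d <- D) d).+1.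
have DA d : d \in D -> (d <= A)%N by move=> dD; apply: leqW; apply: (leq_bigmax_seq (F := id)).
have b0 : (0 : R) < b%:R by rewrite ltr0n ltnW.
have A0 : (0 : R) < A%:R by rewrite ltr0n.
have [q hq] : exists q, 2 * A%:R < e * b%:R ^+ q.
  exists (Num.bound (2 * A%:R / e)).
  rewrite -ltr_pdivrMl // mulrC; apply: lt_trans (archi_boundP _) _.
    by rewrite divr_ge0 ?mulr_ge0 // ltW.
  by rewrite -natrX ltr_nat ltn_expl.
exists q => n qn.
pose y j : R := x0 + j%:R * (2 * A%:R) / b%:R ^+ n.
have bn0 : 0 < b%:R ^+ n :> R by rewrite exprn_gt0.
have yT (j : 'I_(b ^ (n - q))) : digit_attractor b D (y j).
  apply: ballT; rewrite /ball /= /y opprD addNKr normrN ger0_norm; last first.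
    by rewrite divr_ge0 ?mulr_ge0 ?ler0n // ltW.
  rewrite ltr_pdivrMr // -[X in _ ^+ X](subnK qn) exprD [e * _]mulrCA.
  apply: (@le_lt_trans _ _ ((b ^ (n - q))%:R * (2 * A%:R))).
    by rewrite ler_wpM2r ?mulr_ge0 ?ler0n // ler_nat ltnW.
  by rewrite natrX ltr_pM2l // exprn_gt0.
have /choice[u uP] : forall j : 'I_(b ^ (n - q)), exists u,
    u \in digit_sums b D n /\ 0 <= b%:R ^+ n * y j - u%:R <= A%:R.
  by move=> j; have [u] := digit_attractor_approx b1 DA n (yT j); exists u.
have byE j : b%:R ^+ n * y j = b%:R ^+ n * x0 + j%:R * (2 * A%:R).
  by rewrite /y mulrDr mulrCA divff ?gt_eqF // mulr1.
have u_lt (i j : 'I_(b ^ (n - q))) : (i < j)%N -> u i != u j.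
  move=> ij; apply/negP => /eqP uij.
  have [_] := uP i; have [_] := uP j; rewrite uij !byE.
  have : (i%:R + 1 <= j%:R :> R) by rewrite natr1 ler_nat.
  by rewrite -(ler_pM2r A0) mulrDl => ? /andP[? ?] /andP[? ?]; lra.
have u_inj : injective u.
  move=> i j uij; apply/val_inj; case: (ltngtP i j) => // /u_lt.
    by rewrite uij eqxx.
  by rewrite uij eqxx.
rewrite -[X in (X <= _)%N]card_ord -(size_codom u); apply: uniq_leq_size.
  exact/injectiveP.
by move=> v /codomP[j ->]; rewrite mem_undup; have [] := uP j.
Qed.

(** Bernoulli's inequality [(1 + 1/a)^n >= 1 + n/a] with denominators cleared. *)
Lemma bernoulli_nat a n : (a ^ n * (a + n) <= a * a.+1 ^ n)%N.
Proof.
elim: n => [|n IH]; first by rewrite !expn0; lia.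
rewrite !expnS.
have : (a.+1 * (a ^ n * (a + n)) <= a.+1 * (a * a.+1 ^ n))%N.
  by rewrite leq_mul2l IH orbT.
by set x := (a ^ n)%N; set z := (a.+1 ^ n)%N => h; nia.
Qed.

(* A collision at level [k] would cut the number of sums at level [k * n] down
   to [(b^k - 1)^n], which is eventually less than [b^(k * n - q)]. *)
Lemma digit_sums_uniq (R : realType) b (D : {fset nat}) k : (1 < b)%N ->
  tile_digit_set R b D -> uniq (digit_sums b D k).
Proof.
move=> b1 [cardD intT]; have [q hq] := digit_sums_interior b1 intT.
case: k => [//|k]; apply/negPn/negP => nuniq.
have szD : size D = b := cardD.
have B0 : (0 < b ^ k.+1)%N by rewrite expn_gt0 ltnW.
set a := (b ^ k.+1).-1.
have ua : (size (undup (digit_sums b D k.+1)) <= a)%N.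
  by rewrite -ltnS prednK // -[X in (_ < X ^ _)%N]szD -(size_digit_sums b) ltn_size_undup.
have a0 : (0 < a)%N by rewrite /a -ltnS prednK // -{1}(expn0 b) ltn_exp2l.
(* The summand [a * b ^ q] refutes the final bound [a + n <= a * b ^ q]; the summand [q] secures
   [q <= k.+1 * n]. *)
pose n := (q + a * b ^ q)%N.
have qn : (q <= k.+1 * n)%N by rewrite /n; nia.
have n0 : (0 < n)%N by rewrite addn_gt0 muln_gt0 a0 expn_gt0 (ltnW b1) orbT.
have := leq_trans (hq _ qn) (size_undup_digit_sums b D k.+1 n).
move=> /leq_trans; rewrite -(leq_exp2r _ _ n0) in ua; move=> /(_ _ ua).
rewrite -(leq_pmul2l (m := b ^ q)); last by rewrite expn_gt0 ltnW.
rewrite -expnD subnKC // expnM -(prednK B0) -/a => le1.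
have := leq_trans (bernoulli_nat a n) (leq_mul (leqnn a) le1).
have an0 : (0 < a ^ n)%N by rewrite expn_gt0 a0.
rewrite [(b ^ q * _)%N]mulnC mulnCA leq_pmul2l // /n => h; nia.
Qed.

(** * Parseval identity at the roots of unity *)

(** In the expanded square, the pair [(x, y)] contributes the geometric sum of the powers of
    [z^(x - y)], which is [n] if this number is 1 and 0 otherwise. *)
Lemma parseval_unity_root (F : numClosedFieldType) n (z : F) (s : seq nat) :
  n.-primitive_root z ->
  \sum_(t < n) `|\sum_(x <- s) (z ^+ t) ^+ x| ^+ 2 =
  n%:R * \sum_(x <- s) \sum_(y <- s) (x == y %[mod n])%:R.
Proof.
move=> zn; have n0 := prim_order_gt0 zn.
have z1 : `|z| = 1.
  apply/eqP; rewrite -(@pexpr_eq1 _ _ n) // -normrX (prim_expr_order zn).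
  by rewrite normr1.
have z0 : z != 0 by rewrite -normr_eq0 z1 oner_eq0.
have zJ : z^* = z^-1 by rewrite invC_norm z1 expr1n invr1 mul1r.
under eq_bigr => t _.
  rewrite normCK rmorph_sum big_distrl /=.
  under eq_bigr => x _.
    rewrite big_distrr /=.
    under eq_bigr => y _.
      rewrite !rmorphXn /= zJ.
      rewrite -!exprM mulnC [(t * y)%N]mulnC !exprM exprVn -exprMn.
      over.
    over.
  over.
rewrite exchange_big mulr_sumr; apply: eq_bigr => x _.
rewrite exchange_big mulr_sumr; apply: eq_bigr => y _.
have wE : (z ^+ x / z ^+ y == 1) = (x == y %[mod n]).
  rewrite -(eq_prim_root_expr zn) -subr_eq0 -[X in _ - X](divff (expf_neq0 y z0)).
  by rewrite -mulrBl mulf_eq0 invr_eq0 expf_eq0 (negPf z0) andbF orbF subr_eq0.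
have [xy|xy] := boolP (x == y %[mod n]); rewrite -wE in xy.
  rewrite (eqP xy) mulr1; under eq_bigr do rewrite expr1n.
  by rewrite sumr_const card_ord.
rewrite mulr0; set w := z ^+ x / z ^+ y in xy *.
apply/eqP; rewrite -(inj_eq (mulfI (_ : w - 1 != 0))) ?subr_eq0 //.
rewrite mulr0 -subrX1 exprMn exprVn -!exprM mulnC [(y * n)%N]mulnC !exprM.
by rewrite (prim_expr_order zn) !expr1n invr1 mulr1 subrr.
Qed.

(** Elements of one residue class are told apart by their quotients by [n], which are below [A]. *)
Lemma sum_eqmod_le n A (s : seq nat) x : (0 < n)%N -> uniq s ->
  (forall y, y \in s -> y < A * n)%N -> (\sum_(y <- s) (x == y %[mod n]) <= A)%N.
Proof.
move=> n0 us sA.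
have -> : (\sum_(y <- s) (x == y %[mod n]) = count (fun y => x == y %[mod n]) s)%N.
  by rewrite -sum1_count [RHS]big_mkcond.
rewrite -size_filter.
rewrite -(size_map (divn^~ n)) -[leqRHS](size_iota 0).
apply: uniq_leq_size => [|u /mapP[y]].
  rewrite map_inj_in_uniq ?filter_uniq // => y y'.
  rewrite !mem_filter => /andP[/eqP xy _] /andP[/eqP xy' _] yy'.
  by rewrite (divn_eq y n) (divn_eq y' n) yy' -xy -xy'.
rewrite mem_filter mem_iota => /andP[_ /sA yA] ->.
by rewrite add0n ltn_divLR.
Qed.

(** * The complex exponential [exp(i t)] *)

Section ComplexExp.
Context (R : realType).
Implicit Types (t u : R) (z : R[i]).
Local Notation normc := (@Normc.normc R).

Lemma normr_normc z : `|z| = (normc z)%:C%C. Proof. by []. Qed.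

Lemma normc_ge0 z : 0 <= normc z.
Proof. by rewrite -ler0c -normr_normc. Qed.

Lemma ler_normcD z w : normc (z + w) <= normc z + normc w.
Proof. by rewrite -lecR rmorphD /= -!normr_normc ler_normD. Qed.

Lemma normc_nat n : normc n%:R = n%:R.
Proof. by apply: complexI; rewrite -normr_normc normr_nat rmorph_nat. Qed.

Definition expi t : R[i] := (cos t +i* sin t)%C.

Lemma expi0 : expi 0 = 1. Proof. by rewrite /expi cos0 sin0. Qed.

Lemma expiD t u : expi (t + u) = expi t * expi u.
Proof.
rewrite /expi cosD sinD; apply/eqP; rewrite eq_complex /= eqxx /=.
by rewrite addrC.
Qed.

Lemma expi_mulrn t n : expi (t *+ n) = expi t ^+ n.
Proof. by elim: n => [|n IH]; rewrite ?expi0 // mulrS expiD IH exprS. Qed.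

(** The mean value theorem gives possibly different points for [sin] and [cos], so their squares
    need not add up to 1; bounding each by 1 still leaves a factor below 2. *)
Lemma normc_expi_sub1 t : 0 <= t -> normc (expi t - 1) <= 2 * t.
Proof.
move=> t0.
have [c _] := MVT_segment t0 (fun x _ => is_derive_sin x)
  (continuous_subspaceT (@continuous_sin R)).
have [c' _] := MVT_segment t0 (fun x _ => is_derive_cos x)
  (continuous_subspaceT (@continuous_cos R)).
rewrite sin0 cos0 !subr0 => cosE sinE.
have -> : expi t - 1 = ((cos t - 1) +i* sin t)%C.
  by apply/eqP; rewrite eq_complex /= subr0 !eqxx.
rewrite /= cosE sinE !exprMn sqrrN -mulrDl sqrtrM; last first.
  by rewrite addr_ge0 ?sqr_ge0.
rewrite sqrtr_sqr ger0_norm // ler_wpM2r //.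
rewrite -[leRHS]ger0_norm // -sqrtr_sqr ler_wsqrtr //.
have s1 (x : R) : sin x ^+ 2 <= 1 by rewrite sin2cos2 gerBl sqr_ge0.
have c1 (x : R) : cos x ^+ 2 <= 1 by rewrite cos2sin2 gerBl sqr_ge0.
by have := s1 c'; have := c1 c; lra.
Qed.

Lemma expi_prim_root n : (0 < n)%N -> n.-primitive_root (expi (pi *+ 2 / n%:R)).
Proof.
move=> n0; have nR0 : (0 : R) < n%:R by rewrite ltr0n.
apply/andP; split=> //; apply/forallP => i; rewrite unity_rootE.
rewrite -expi_mulrn; apply/eqP.
have [->|] := eqVneq i.+1 n.
  by rewrite -[X in expi X]mulr_natr (divfK (lt0r_neq0 nR0)) /expi cos2pi sin2pi eqxx.
rewrite neq_ltn => /orP[lt_in|]; last by rewrite ltnNge ltn_ord.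
apply/negbTE; rewrite eq_complex negb_and /=; apply/orP; left.
(* With [u] half the angle, the real part is [1 - 2 sin(u)^2 < 1]. *)
pose u : R := pi / n%:R *+ i.+1.
have -> : pi *+ 2 / n%:R *+ i.+1 = u *+ 2 :> R.
  by rewrite /u -!mulrnA mulnC mulrnA !mulrnAl -!mulrnA mulnC.
have u_gt0 : 0 < u by rewrite pmulrn_lgt0 // divr_gt0 ?pi_gt0.
have u_lt : u < pi.
  by rewrite /u -mulr_natr mulrAC ltr_pdivrMr // ltr_pM2l ?pi_gt0 // ltr_nat.
have : 0 < sin u by rewrite sin_gt0_pi // u_gt0.
rewrite cos_mulr2n cos2sin2 => su; rewrite lt_eqF //.
by have := exprn_gt0 2 su; lra.
Qed.

End ComplexExp.

(** * Kenyon's criterion *)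

(** Used with [p = pi], [X = A' * m] and [k = b ^ K]; the constant 32 originates here. *)
Lemma pi_bound_step (F : realFieldType) (p X k : F) :
  0 <= X -> p <= 2 * 2 -> 32 * X <= k -> p * (4 * X) <= k / 2.
Proof.
by move=> X0 p4 Xk; have := ler_wpM2r (mulr_ge0 (ler0n F 4) X0) p4; lra.
Qed.

(** With [B = b] and [u = b ^ i], the loss [e] in one factor is small enough for a lower bound
    proportional to [b ^ i + 1] to pass on to [b ^ i.+1 + 1]. *)
Lemma tail_factor_step (F : realFieldType) (B u : F) : 2 <= B -> 1 <= u ->
  let e := (B * u)^-1 / 2 in 0 <= B - e /\ B * u + 1 <= (B - e) * (u + 1).
Proof.
move=> B2 u1 e.
have Bu : 2 * u <= B * u by rewrite ler_wpM2r //; lra.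
have e0 : 0 <= e by rewrite divr_ge0 // invr_ge0; lra.
have e_le : e * (u + 1) <= 1.
  by rewrite /e -mulrA mulrC ler_pdivrMr; lra.
have e1 : e <= 1 by apply: le_trans e_le; rewrite ler_peMr //; lra.
by split; lra.
Qed.

Section Kenyon.
Context (R : realType) (b : nat) (D : {fset nat}).
Hypotheses (b1 : (1 < b)%N) (tileD : tile_digit_set R b D).
Local Notation normc := (@Normc.normc R).

Let sizeD : size D = b. Proof. by case: tileD. Qed.
Let b0 : (0 < b)%N. Proof. exact: ltnW. Qed.

Definition sums_eval n (z : R[i]) := \sum_(x <- digit_sums b D n) z ^+ x.

Lemma sums_eval0 z : sums_eval 0 z = 1.
Proof. by rewrite /sums_eval big_seq1. Qed.

Lemma sums_evalS n z :
  sums_eval n.+1 z = (\sum_(d <- D) z ^+ d) * sums_eval n (z ^+ b).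
Proof.
rewrite /sums_eval big_allpairs_dep /= big_distrl /=; apply: eq_bigr => d _.
by rewrite big_distrr /=; apply: eq_bigr => x _; rewrite exprD exprM.
Qed.

Lemma sums_evalD m n z :
  sums_eval (m + n) z = sums_eval m z * sums_eval n (z ^+ (b ^ m)).
Proof.
elim: m z => [|m IH] z; first by rewrite sums_eval0 mul1r expr1.
by rewrite addSn !sums_evalS IH mulrA -exprM -expnS.
Qed.

Lemma sums_eval_one n : sums_eval n 1 = (b ^ n)%:R.
Proof.
rewrite /sums_eval; under eq_bigr do rewrite expr1n.
by rewrite big_const_seq count_predT iter_addr_0 size_digit_sums sizeD.
Qed.

Let zeta n : R[i] := expi (pi *+ 2 / (b ^ n)%:R).

Let zeta_prim n : (b ^ n)%N.-primitive_root (zeta n).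
Proof. by apply: expi_prim_root; rewrite expn_gt0 b0. Qed.

Let zetaX n i : zeta (n + i) ^+ (b ^ i) = zeta n.
Proof.
rewrite /zeta -expi_mulrn -[X in expi X]mulr_natr expnD natrM invfM -!mulrA.
by rewrite mulVf ?mulr1 // pnatr_eq0 -lt0n expn_gt0 b0.
Qed.

(** The digit sums are distinct and below [A * b ^ N], so each is congruent to at most [A] of them
    modulo [b ^ N], with [A] independent of [N]. *)
Lemma sums_eval_bessel : exists A : nat, forall N,
  \sum_(t < b ^ N) normc (sums_eval N (zeta N ^+ t)) ^+ 2 <=
  A%:R * (b ^ N)%:R ^+ 2.
Proof.
pose A := (\max_(d <- D) d).+1; exists A => N.
have DA d : d \in D -> (d <= A)%N.
  by move=> dD; apply: leqW; apply: (leq_bigmax_seq (F := id)).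
have M0 : (0 < b ^ N)%N by rewrite expn_gt0 b0.
rewrite -lecR rmorph_sum /=; under eq_bigr do rewrite rmorphXn /= -normr_normc.
rewrite (parseval_unity_root _ (zeta_prim N)) -natrX -natrM rmorph_nat.
under eq_bigr do rewrite -natr_sum.
rewrite -natr_sum -natrM ler_nat -mulnn mulnCA leq_pmul2l //.
rewrite [leqRHS]mulnC -[X in (_ <= X ^ _ * _)%N]sizeD -(size_digit_sums b D N).
rewrite -sum1_size big_distrl /=; apply: leq_sum => x _; rewrite mul1n.
apply: sum_eqmod_le => // [|y /(digit_sums_le b1 DA)].
  exact: digit_sums_uniq tileD.
by rewrite /A; lia.
Qed.

Let A' := (\sum_(d <- D) d)%N.

(** Reverse triangle inequality around the value [b] at 1, with [|1 - exp(i t d)| <= 2 t d] for each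
    digit. *)
Lemma mask_eval_ge t : 0 <= t ->
  b%:R - 2 * A'%:R * t <= normc (\sum_(d <- D) expi t ^+ d).
Proof.
move=> t0; rewrite lerBlDr.
have -> : b%:R = normc b%:R :> R by rewrite normc_nat.
have -> : b%:R = \sum_(d <- D) expi t ^+ d + \sum_(d <- D) (1 - expi t ^+ d).
  rewrite -big_split /=; under eq_bigr do rewrite addrC subrK.
  by rewrite big_const_seq count_predT iter_addr_0 sizeD.
apply: le_trans (ler_normcD _ _) _; rewrite lerD2l.
rewrite /A' natr_sum mulrAC mulr_sumr.
elim/big_ind2: _ => [|x1 x2 y1 y2 h1 h2|d _].
- by rewrite (normc_nat R 0).
- exact: le_trans (ler_normcD _ _) (lerD h1 h2).
rewrite -lecR -normr_normc distrC normr_normc lecR -expi_mulrn.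
apply: le_trans (normc_expi_sub1 _) _; first by rewrite mulrn_wge0.
by rewrite mulr_natr -mulrnAr.
Qed.

(** This is the product of the mask values at [zeta k ^+ m] for [1 <= k <= n], so raising [n] by one
    appends one factor. *)
Let h m n := sums_eval n (zeta n ^+ m).

Let hS m n : h m n.+1 = (\sum_(d <- D) (zeta n.+1 ^+ m) ^+ d) * h m n.
Proof. by rewrite /h sums_evalS exprAC -[X in _ ^+ X ^+ m]expn1 -(addn1 n) zetaX. Qed.

(** The factors of index beyond [K] are so close to [b] that the first [i] of them multiply to at
    least [(b ^ i + 1) / 2] in modulus. *)
Let h_lower m K i : (32 * A' * m <= b ^ K)%N ->
  normc (h m K) * (b%:R ^+ i + 1) <= 2 * normc (h m (K + i)).
Proof.
move=> mK; elim: i => [|i IH].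
  by rewrite addn0 expr0 mulrC.
rewrite addnS hS Normc.normcM.
set g := \sum_(d <- D) _.
have bR : 2 <= b%:R :> R by rewrite ler_nat.
pose e : R := (b%:R ^+ i.+1)^-1 / 2.
have ge_g : b%:R - e <= normc g.
  pose x : R := pi *+ 2 / (b ^ (K + i).+1)%:R *+ m.
  have x0 : 0 <= x.
    by apply/mulrn_wge0/divr_ge0; rewrite ?ler0n // mulrn_wge0 ?pi_ge0.
  have -> : g = \sum_(d <- D) expi x ^+ d.
    by apply: eq_bigr => d _; rewrite /x expi_mulrn.
  apply: le_trans (mask_eval_ge x0); rewrite lerD2l lerN2.
  have bi0 : 0 < b%:R ^+ i.+1 :> R by rewrite exprn_gt0 // ltr0n.
  have bK0 : 0 < b%:R ^+ K :> R by rewrite exprn_gt0 // ltr0n.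
  have -> : 2 * A'%:R * x =
      pi * (4 * (A'%:R * m%:R)) / (b%:R ^+ K * b%:R ^+ i.+1).
    by rewrite /x -addnS natrX exprD -[X in _ * X = _]mulr_natr; ring.
  rewrite ler_pdivrMr ?mulr_gt0 // /e.
  have -> : (b%:R ^+ i.+1)^-1 / 2 * (b%:R ^+ K * b%:R ^+ i.+1) = b%:R ^+ K / 2 :> R.
    by field; rewrite gt_eqF // ltr0n.
  have Am0 : 0 <= A'%:R * m%:R :> R by rewrite mulr_ge0 ?ler0n.
  have : 32 * (A'%:R * m%:R) <= b%:R ^+ K :> R.
    by rewrite -natrX mulrA -!natrM ler_nat.
  have [/andP[_]] := pihalf_02_cos_pihalf R.
  rewrite ler_pdivrMr // => pi4 _.
  exact: pi_bound_step.
have bi1 : 1 <= b%:R ^+ i :> R by rewrite exprn_ege1 // ler1n.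
have [be0 be_le] := tail_factor_step bR bi1; rewrite -exprS -/e in be0 be_le.
have hK0 := normc_ge0 (h m K).
apply: (@le_trans _ _ ((b%:R - e) * (normc (h m K) * (b%:R ^+ i + 1)))).
  by rewrite [leRHS]mulrCA ler_wpM2l.
rewrite [leRHS]mulrCA; apply: (@le_trans _ _ ((b%:R - e) * (2 * normc (h m (K + i))))).
  exact: ler_wpM2l be0 _ _ IH.
exact: ler_wpM2r (mulr_ge0 (ler0n _ 2) (normc_ge0 _)) _ _ ge_g.
Qed.

(* The frequencies [m * b^i] contradict [sums_eval_bessel] unless some factor
   [P_D(zeta_k^m)] vanishes; factors with [k > K] are too close to [b] for that. *)
Lemma Cyclotomic_dvd_mask_poly : exists A, forall m K, (0 < m)%N ->
  (A * m <= b ^ K)%N ->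
  exists2 k, (0 < k <= K)%N & 'Phi_(b ^ k %/ gcdn m (b ^ k)) %| mask_poly D.
Proof.
(* The part [32 * A'] serves [h_lower]; the part 2 gives [m < b ^ K], which keeps the frequencies
   below the modulus. *)
exists (32 * A' + 2)%N => m K m0 mK; apply: contrapT => noPhi.
have mK1 : (32 * A' * m <= b ^ K)%N by nia.
have mK2 : (m < b ^ K)%N by nia.
have h_neq0 n : (n <= K)%N -> h m n != 0.
  elim: n => [|n IH] nK; first by rewrite /h sums_eval0 oner_eq0.
  rewrite hS; apply: mulf_neq0 (IH (ltnW nK)); apply/eqP => mask0.
  apply: noPhi; exists n.+1; rewrite ?nK //.
  rewrite (dvd_Cyclotomic_root _ (exp_prim_root (zeta_prim n.+1) m)).
  rewrite /mask_poly rmorph_sum /=; apply/eqP; rewrite horner_sum -[RHS]mask0.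
  by apply: eq_bigr => d _; rewrite map_polyXn hornerXn.
set r := normc (h m K).
have r0 : 0 < r.
  rewrite lt_neqAle normc_ge0 andbT eq_sym; apply/eqP => /Normc.eq0_normc/eqP.
  by rewrite (negPf (h_neq0 K (leqnn K))).
have [A bessel] := sums_eval_bessel.
(* Each of the [n] frequencies [m * b ^ i] contributes at least [(r * b ^ n / 2) ^ 2] to the Bessel
   sum at level [K + n]. A bound uniform in [n] is absurd for [r > 0]. *)
have bound n : n%:R * r ^+ 2 <= 4 * A%:R * (b ^ K)%:R ^+ 2.
  have f_lt (i : 'I_n) : (m * b ^ i < b ^ (K + n))%N.
    rewrite expnD; apply: (@leq_trans (b ^ K * b ^ i)).
      by rewrite ltn_pmul2r // expn_gt0 b0.
    by rewrite leq_pmul2l ?expn_gt0 ?b0 // leq_pexp2l // ltnW.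
  pose f i := Ordinal (f_lt i).
  have f_inj : injective f.
    move=> i j [/eqP]; rewrite eqn_pmul2l // eqn_exp2l // => /eqP.
    exact: val_inj.
  have term (i : 'I_n) : r ^+ 2 * (b ^ n)%:R ^+ 2 <=
      4 * normc (sums_eval (K + n) (zeta (K + n) ^+ f i)) ^+ 2.
    have -> : zeta (K + n) ^+ f i = zeta (K + (n - i)) ^+ m.
      rewrite /= mulnC exprM -(zetaX (K + (n - i)) i) -addnA subnK //.
      exact: ltnW.
    have -> : (K + n = K + (n - i) + i)%N by rewrite -addnA subnK // ltnW.
    (* The top [i] digits are evaluated at 1 and contribute the full factor [b ^ i]. *)
    rewrite sums_evalD -/(h m _) exprAC (prim_expr_order (zeta_prim _)) expr1n.
    rewrite sums_eval_one Normc.normcM normc_nat.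
    have le_h : r * _ <= _ := h_lower (n - i) mK1.
    have y0 := normc_ge0 (h m (K + (n - i))).
    set y := normc _ in le_h y0 *; clearbody y.
    have -> : 4 * (y * (b ^ i)%:R) ^+ 2 = (2 * y * (b ^ i)%:R) ^+ 2 by ring.
    rewrite -exprMn ler_sqr ?nnegrE ?mulr_ge0 ?ler0n ?(ltW r0) //.
    have -> : (b ^ n = b ^ (n - i) * b ^ i)%N by rewrite -expnD subnK // ltnW.
    rewrite natrM mulrA ler_wpM2r ?ler0n // (le_trans _ le_h) //.
    by rewrite ler_wpM2l ?(ltW r0) // natrX lerDl.
  have bn0 : 0 < (b ^ n)%:R ^+ 2 :> R by rewrite exprn_gt0 // ltr0n expn_gt0 b0.
  rewrite -(ler_pM2r bn0).
  have -> : n%:R * r ^+ 2 * (b ^ n)%:R ^+ 2 =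
      \sum_(i < n) r ^+ 2 * (b ^ n)%:R ^+ 2.
    by rewrite sumr_const card_ord -mulrA mulr_natl.
  apply: le_trans (ler_sum _ (fun i _ => term i)) _.
  have -> : 4 * A%:R * (b ^ K)%:R ^+ 2 * (b ^ n)%:R ^+ 2 =
      4 * (A%:R * (b ^ (K + n))%:R ^+ 2) :> R.
    by rewrite expnD natrM; ring.
  rewrite -mulr_sumr ler_pM2l // (le_trans _ (bessel (K + n)%N)) //.
  rewrite [leRHS](bigID [in f @: [set: 'I_n]%SET]) /=.
  rewrite big_imset /=; last by move=> i j _ _; exact: f_inj.
  rewrite [X in _ <= X + _](eq_bigl predT) => [|i]; last by rewrite inE.
  by rewrite lerDl sumr_ge0 // => t _; rewrite sqr_ge0.
set c := 4 * A%:R * _ in bound.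
have c0 : 0 <= c by rewrite !mulr_ge0 ?ler0n ?sqr_ge0.
have r20 : 0 < r ^+ 2 by rewrite exprn_gt0.
have := archi_boundP (divr_ge0 c0 (ltW r20)).
by rewrite ltr_pdivrMr // ltNge bound.
Qed.

End Kenyon.

(** * The prime-power spectrum of a tile digit set *)

Lemma mask_poly_horner1 (D : {fset nat}) : (mask_poly D).[1] = (#|` D|%fset)%:R.
Proof.
rewrite /mask_poly horner_sum; under eq_bigr do rewrite hornerXn expr1n.
by rewrite big_const_seq count_predT iter_addr_0.
Qed.

(** Excludes the exponent 0: ['Phi_1 = X - 1] vanishes at 1, where the mask polynomial counts the
    digits. *)
Lemma Cyclotomic1_ndvd_mask_poly (D : {fset nat}) :
  (0 < #|` D|%fset)%N -> ~~ ('Phi_1 %| mask_poly D).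
Proof.
move=> D0; apply/negP => /dvd_CyclotomicP[Q /(congr1 (horner^~ 1))].
rewrite mask_poly_horner1 Cyclotomic1 hornerM hornerXsubC subrr mulr0 => /eqP.
by rewrite pnatr_eq0 -leqn0 leqNgt D0.
Qed.

Lemma size_spectrum_le (D : {fset nat}) p (cs : seq nat) : prime p ->
  (0 < #|` D|%fset)%N -> uniq cs ->
  (forall c, c \in cs -> 'Phi_(p ^ c) %| mask_poly D) ->
  (size cs <= logn p #|` D|%fset)%N.
Proof.
move=> pp D0 ucs dvdP.
have cs0 : 0%N \notin cs.
  by apply/negP => /dvdP; rewrite expn0 (negPf (Cyclotomic1_ndvd_mask_poly D0)).
have [x] := dvdn_primeX_card pp ucs cs0 dvdP; rewrite mask_poly_horner1 => xE.
rewrite -pfactor_dvdn //; apply/dvdnP; exists `|x|%N.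
by have := congr1 absz xE; rewrite abszM !natz !absz_nat.
Qed.

(* Take [m = (b / p^alpha)^K * p^(alpha - l)]: for [0 < k <= K] the reduced
   denominator of [m / b^k] is [p^(alpha * (k - 1) + l)]. *)
Lemma Cyclotomic_primeX_dvd_mask_poly (R : realType) b (D : {fset nat}) p l :
  (1 < b)%N -> tile_digit_set R b D -> prime p -> (l < logn p b)%N ->
  exists c, (c = l %[mod logn p b])%N /\ 'Phi_(p ^ c) %| mask_poly D.
Proof.
move=> b1 tileD pp; set al := logn p b => lal.
have b0 : (0 < b)%N := ltnW b1.
have [b' pb' bE] := pfactor_coprime pp b0; rewrite -/al in bE.
have b'0 : (0 < b')%N by move: b0; rewrite bE muln_gt0 => /andP[].
have p0 := prime_gt0 pp.
have [A kenyon] := Cyclotomic_dvd_mask_poly b1 tileD.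
(* Once [b' ^ K] is cancelled, the size condition of [kenyon] follows from [A * p ^ s <= p ^ A * p ^
   s = p ^ K <= p ^ (al * K)]. *)
pose s := (al - l)%N; pose K := (s + A)%N.
have [| |k /andP[k0 kK]] := kenyon (b' ^ K * p ^ s)%N K.
- by rewrite muln_gt0 !expn_gt0 b'0 p0.
- rewrite bE expnMn mulnCA leq_pmul2l ?expn_gt0 ?b'0 // -expnM.
  apply: (@leq_trans (p ^ K)%N); last by rewrite leq_pexp2l // leq_pmull //; lia.
  by rewrite /K addnC expnD leq_pmul2r ?expn_gt0 ?p0 // ltnW // ltn_expl ?prime_gt1.
have sk : (s <= al * k)%N by rewrite /s; nia.
(* The gcd is [b' ^ k * p ^ s], the cofactors [b' ^ (K - k)] and [p ^ (al * k - s)] being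
   coprime. *)
have -> : (b' ^ K * p ^ s = b' ^ k * p ^ s * b' ^ (K - k))%N.
  by rewrite -{1}(subnKC kK) expnD mulnAC.
have -> : (b ^ k = b' ^ k * p ^ s * p ^ (al * k - s))%N.
  by rewrite bE expnMn -expnM -{1}(subnKC sk) expnD mulnA.
rewrite -muln_gcdr (_ : gcdn _ _ = 1%N); last first.
  by apply/eqP; rewrite -/(coprime _ _) coprimeXl // coprimeXr // coprime_sym.
rewrite muln1 mulKn ?muln_gt0 ?expn_gt0 ?b'0 ?p0 // => dvdP.
exists (al * k - s)%N; split=> //.
have -> : (al * k - s = k.-1 * al + l)%N by rewrite /s; nia.
by rewrite modnMDl.
Qed.

Lemma logn_prod_primes k (p alpha : 'I_k -> nat) q : (forall j, prime (p j)) ->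
  prime q ->
  logn q (\prod_(j < k) p j ^ alpha j) = (\sum_(j < k) alpha j * (q == p j))%N.
Proof.
move=> pp pq; suff [] : (0 < \prod_(j < k) p j ^ alpha j)%N /\
  logn q (\prod_(j < k) p j ^ alpha j) = (\sum_(j < k) alpha j * (q == p j))%N by [].
elim/big_rec2: _ => [|j y x _ [x0 xE]]; first by rewrite logn1.
have pj0 : (0 < p j ^ alpha j)%N by rewrite expn_gt0 prime_gt0.
by rewrite muln_gt0 pj0 x0 lognM // lognX logn_prime // xE.
Qed.

Theorem theorem2p4 (R : realType) (b : nat) (hb : (1 < b)%N)
    (k : nat) (p alpha : 'I_k -> nat)
    (p_prime : forall j, prime (p j)) (p_inj : injective p)
    (alpha_ge1 : forall j, (1 <= alpha j)%N)
    (b_fact : b = (\prod_(j < k) p j ^ alpha j)%N)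
    (D : {fset nat}) (hD : tile_digit_set R b D) :
  exists a : 'I_k -> nat -> nat,
    (forall (j : 'I_k) (l : nat), (l < alpha j)%N ->
       unique (fun c : nat => (c = l %[mod alpha j])%N /\
                              'Phi_(p j ^ c) %| mask_poly D) (a j l)) /\
    prime_power_spectrum D =
      \bigcup_(j in [set: 'I_k]) [set (p j ^ a j l)%N | l in `I_(alpha j)].
Proof.
have cardD : #|` D|%fset = b by case: hD.
have D0 : (0 < #|` D|%fset)%N by rewrite cardD ltnW.
have logb q : prime q -> logn q b = (\sum_(j < k) alpha j * (q == p j))%N.
  by move=> pq; rewrite b_fact logn_prod_primes.
have logp j : logn (p j) b = alpha j.
  rewrite logb // (bigD1 j) //= eqxx muln1 big1 ?addn0 // => i ij.
  by rewrite (inj_eq p_inj) eq_sym (negPf ij) muln0.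
(* The bound on [jl.2] sits inside the existential so that [choice] yields a total function; out of
   range any value will do. *)
have ex (jl : 'I_k * nat) : exists c, (jl.2 < alpha jl.1)%N ->
    (c = jl.2 %[mod alpha jl.1])%N /\ 'Phi_(p jl.1 ^ c) %| mask_poly D.
  case: jl => j l /=; have [lt_l|_] := ltnP l (alpha j); last by exists 0%N.
  rewrite -logp in lt_l *.
  by have [c] := Cyclotomic_primeX_dvd_mask_poly hb hD (p_prime j) lt_l; exists c.
have [f fP] := choice ex; pose a j l := f (j, l).
have aP j l (lt_l : (l < alpha j)%N) := fP (j, l) lt_l.
have a_mod j l : (l < alpha j)%N -> (a j l %% alpha j = l)%N.
  by move=> lt_l; rewrite (aP j l lt_l).1 modn_small.
have a_uniq j c : 'Phi_(p j ^ c) %| mask_poly D -> a j (c %% alpha j)%N = c.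
  move=> dvd_c; apply/eqP/negPn/negP => neq_c.
  (* A missed [c] would join the [alpha j] values [a j l], giving one exponent more than the
     valuation of [b] at [p j] allows. *)
  pose cs := c :: [seq a j l | l <- iota 0 (alpha j)].
  have := @size_spectrum_le D (p j) cs (p_prime j) D0.
  rewrite /= size_map size_iota cardD logp ltnn => absurd.
  suff: false by []; apply: absurd => [|d].
    apply/andP; split.
      apply/negP => /mapP[l]; rewrite mem_iota add0n => lt_l cE.
      by move: neq_c; rewrite cE a_mod // eqxx.
    rewrite map_inj_in_uniq ?iota_uniq // => l l'.
    rewrite !mem_iota !add0n => lt_l lt_l' /(congr1 (modn^~ (alpha j))).
    by rewrite !a_mod.
  rewrite inE => /predU1P[-> //|/mapP[l]]; rewrite mem_iota add0n => lt_l ->.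
  exact: (aP j l lt_l).2.
exists a; split=> [j l lt_l|].
  split; first exact: aP.
  by move=> c [cl /a_uniq <-]; rewrite cl modn_small.
apply/seteqP; split=> q /=.
  move=> [p' [e [pp' qE q1 dvd_q]]]; rewrite qE in q1 dvd_q *.
  (* The single exponent [e] already forces [p'] to divide [b]. *)
  have pos : (size [:: e] <= logn p' b)%N.
    rewrite -cardD; apply: size_spectrum_le => // d.
    by rewrite inE => /eqP ->.
  rewrite logb // in pos.
  have [j p'E] : exists j, p' = p j.
    apply: contrapT => nex; move: pos; rewrite big1 // => j _.
    by case: eqP => [p'E|]; rewrite ?muln0 //; case: nex; exists j.
  rewrite p'E in dvd_q *; exists j => //.
  exists (e %% alpha j)%N; first by rewrite /= ltn_mod.
  by rewrite a_uniq.
move=> [j _ [l /= lt_l <-]]; exists (p j), (a j l); split=> //.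
  rewrite -(exp1n (a j l)) ltn_exp2r ?prime_gt1 // lt0n; apply/eqP => a0.
  have := (aP j l lt_l).2; rewrite /= -/(a j l) a0 expn0.
  by rewrite (negPf (Cyclotomic1_ndvd_mask_poly D0)).
exact: (aP j l lt_l).2.
Qed.
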